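(* Let $\lambda_1,\ldots,\lambda_n\in(0,1)$, let $p_1,\ldots,p_n\in\mathbb{R}^d$, let $f_j(x)=\lambda_j x+(1-\lambda_j)p_j$ for $1\le j\le n$, and let $\Lambda\subset\mathbb{R}^d$ be the attractor of $\{f_j\}_{j=1}^n$. Assume that $f_k(\Lambda)\cap f_l(\Lambda)$ has nonempty interior for some $1\le k<l\le n$. Then the set of points $x\in\Lambda$ that do not have a continuum of codings (i.e. whose set of codings does not have cardinality $2^{\aleph_0}$) has Hausdorff dimension strictly less than $d$.
   Context: The attractor $\Lambda$ of $\{f_j\}_{j=1}^n$ is the unique nonempty compact set $\Lambda\subset\mathbb{R}^d$ with $\Lambda=\bigcup_{j=1}^n f_j(\Lambda)$. A coding of $x\in\Lambda$ is a sequence $(\epsilon_i)_{i=1}^\infty\in\{1,\ldots,n\}^{\mathbb{N}}$ such that $\lim_{N\to\infty}f_{\epsilon_1}\cdots f_{\epsilon_N}(0)=x$, where $f_{\epsilon_1}\cdots f_{\epsilon_N}$ denotes the composition $f_{\epsilon_1}\circ\cdots\circ f_{\epsilon_N}$. *)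

(* Defs.v *)
From HB Require Import structures.
From mathcomp Require Export all_boot all_order all_algebra.
From mathcomp Require Export all_classical all_reals all_analysis.

Set Implicit Arguments.
Unset Strict Implicit.
Unset Printing Implicit Defensive.

Import Order.TTheory GRing.Theory Num.Theory.
Import numFieldNormedType.Exports.

Local Open Scope classical_set_scope.
Local Open Scope ring_scope.

Section Hausdorff.
Context {R : realType} {d : nat}.
Implicit Types (x y : 'rV[R]_d) (A U : set 'rV[R]_d) (s delta : R).

(* The library norm on 'rV[R]_d is the sup norm, so the Euclidean distance is
   introduced explicitly. *)
Definition edist x y : R := Num.sqrt (\sum_(i < d) (x 0 i - y 0 i) ^+ 2).

(* Meaningful for U nonempty; diam set0 = -oo. *)
Definition diam U : \bar R :=
  ereal_sup [set r | exists x y, [/\ U x, U y & r = (edist x y)%:E]].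

(* The empty set has weight 0 for every s, including s = 0; a singleton has
   weight 0 `^ 0 = 1 for s = 0, so that the measure below is then the counting
   measure. *)
Definition diam_pow s U : \bar R :=
  if U == set0 then 0%E else poweR (diam U) s.

Definition delta_cover delta A (U : nat -> set 'rV[R]_d) : Prop :=
  A `<=` \bigcup_i U i /\ forall i, (diam (U i) <= delta%:E)%E.

Definition hausdorff_premeasure s delta A : \bar R :=
  ereal_inf [set r | exists2 U, delta_cover delta A U &
                     r = (\sum_(0 <= i <oo) diam_pow s (U i))%E].

(* The premeasure is nonincreasing in delta, so the limit as delta -> 0+ is
   the supremum over delta > 0. *)
Definition hausdorff_measure s A : \bar R :=
  ereal_sup [set hausdorff_premeasure s delta A | delta in [set e | 0 < e]].

Definition hausdorff_dim A : \bar R :=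
  ereal_inf [set s%:E | s in [set s | 0 <= s /\ hausdorff_measure s A = 0%E]].

End Hausdorff.

Section IFS.
Context {R : realType} {d n : nat}.
Implicit Types (f : 'I_n -> 'rV[R]_d -> 'rV[R]_d) (L : set 'rV[R]_d).

Definition homothety_ifs (lam : 'I_n -> R) (p : 'I_n -> 'rV[R]_d) :
    'I_n -> 'rV[R]_d -> 'rV[R]_d :=
  fun j x => lam j *: x + (1 - lam j) *: p j.

(* For contractions these conditions determine L uniquely (Hutchinson). *)
Definition is_attractor f L : Prop :=
  [/\ L !=set0, compact L & L = \bigcup_(j in [set: 'I_n]) (f j @` L)].

(* Sequences are indexed from 0:
   prefix_comp f eps N = f (eps 0) \o ... \o f (eps N.-1). *)
Fixpoint prefix_comp f (eps : nat -> 'I_n) (N : nat) :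
    'rV[R]_d -> 'rV[R]_d :=
  if N is N'.+1 then prefix_comp f eps N' \o f (eps N') else id.

Definition codings f (x : 'rV[R]_d) : set (nat -> 'I_n) :=
  [set eps | prefix_comp f eps N 0 @[N --> \oo] --> x].

End IFS.

Definition has_continuum_card (T : Type) (A : set T) : Prop :=
  (A #= [set: nat -> bool])%card.

(* Main.v *)
(* Let [U] be the overlap of the images of [L] under the maps [k] and [l].  If
   every point reached from [x] by applying inverse branches inside [L] can be
   moved on into [U], then [x] has a continuum of codings, since at each visit
   to [U] both letters [k] and [l] are available.  Otherwise [x] lies in
   [word_map w @` avoiding U] for some finite word [w], where [avoiding U] is
   the set of points of [L] lying in no image of [U] under a finite word.
   Since [U] contains a ball and every point of [L] lies, at every scale, in a
   homothetic copy of [L] of comparable size, [avoiding U] is uniformly porous: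
   when a cube is cut into [m ^ d] subcubes, with a fixed [m], at least one of
   them misses the set.  Hence [(m ^ d - 1) ^ k] cubes of side [m ^ - k] cover
   it, which gives a dimension smaller than [d]; there are only countably many
   words [w], so the bound passes to the union. *)

Require Import Defs.
From mathcomp Require Import ring lra.
Import Order.TTheory GRing.Theory Num.Theory.
Import numFieldNormedType.Exports.
Local Open Scope classical_set_scope.
Local Open Scope ring_scope.

(** * Null Hausdorff measure from covers by equal cubes *)

Section BoxCovers.
Context {R : realType} {d : nat}.
Implicit Types (x y c : 'rV[R]_d) (A F : set 'rV[R]_d) (s r : R).

Definition cube c r : set 'rV[R]_d :=
  [set x | forall i, c 0 i <= x 0 i <= c 0 i + r].

(** One [e] bounds both the side and the total weight, so a single choice meets the scale constraint
    of the premeasure and makes the sum small. Side 0 is allowed, so an empty list serves for the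
    empty set. *)
Definition box_null s F := forall e : R, 0 < e ->
  exists (C : seq 'rV[R]_d) (r : R),
    [/\ 0 <= r <= e, F `<=` \bigcup_(c in [set` C]) cube c r &
        (size C)%:R * r `^ s <= e].

Lemma edist_le x y r : 0 <= r -> (forall i, `|x 0 i - y 0 i| <= r) ->
  edist x y <= d%:R * r.
Proof.
move=> r0 xyr; rewrite /edist -(@ger0_norm _ (d%:R * r)) ?mulr_ge0//.
rewrite -sqrtr_sqr ler_sqrt ?sqr_ge0//.
apply: (@le_trans _ _ (\sum_(i < d) r ^+ 2)).
  by apply: ler_sum => i _; rewrite -real_normK ?num_real// ler_sqr ?nnegrE.
rewrite sumr_const card_ord exprMn -[leLHS]mulr_natl ler_wpM2r ?sqr_ge0//.
(* The crude factor [d] replaces its square root, by [d <= d ^ 2] in [nat]. *)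
by rewrite -natrX ler_nat; case: (d) => // k; rewrite leq_pmulr.
Qed.

Lemma diam_cube_le c r : 0 <= r -> (diam (cube c r) <= (d%:R * r)%:E)%E.
Proof.
move=> r0; apply: ge_ereal_sup => _ [x [y [cx cy ->]]].
rewrite lee_fin; apply: edist_le => // i.
have /andP[? ?] := cx i; have /andP[? ?] := cy i.
by rewrite ler_distl; apply/andP; split; lra.
Qed.

Lemma edist_xx x : edist x x = 0.
Proof. by rewrite /edist big1 ?sqrtr0// => i _; rewrite subrr expr0n. Qed.

Lemma diam_ge0 A : A !=set0 -> (0 <= diam A)%E.
Proof.
move=> [x Ax]; apply: ereal_sup_ubound; exists x, x.
by rewrite edist_xx.
Qed.

Lemma diam0 : diam (set0 : set 'rV[R]_d) = -oo%E.
Proof.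
by apply/eqP; rewrite -leeNy_eq; apply: ge_ereal_sup => z [x [y []]].
Qed.

Lemma diam_pow_ge0 s A : (0 <= diam_pow s A)%E.
Proof. by rewrite /diam_pow; case: ifP => // _; exact: poweR_ge0. Qed.

Lemma diam_pow_cube_le s c r : 0 <= s -> 0 <= r ->
  (diam_pow s (cube c r) <= ((d%:R * r) `^ s)%:E)%E.
Proof.
move=> s0 r0; rewrite /diam_pow; case: ifPn => [_|/set0P ne].
  by rewrite lee_fin powR_ge0.
rewrite -poweR_EFin; apply: gt0_ler_poweR => //; last exact: diam_cube_le.
- by rewrite in_itv/= diam_ge0//= leey.
- by rewrite in_itv/= lee_fin mulr_ge0//= leey.
Qed.

(** With nonnegative terms both sides are unordered sums, which can be reindexed along a bijection
    and iterated. *)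
Lemma nneseries_pair (g : nat -> nat * nat) (a : nat * nat -> \bar R) :
  set_bij setT setT g -> (forall p, 0 <= a p)%E ->
  (\sum_(0 <= k <oo) a (g k) = \sum_(0 <= i <oo) \sum_(0 <= j <oo) a (i, j))%E.
Proof.
move=> bij_g a0; rewrite !nneseries_esumT//; last first.
  by move=> i; exact: nneseries_ge0.
under [RHS]eq_esum do rewrite nneseries_esumT//.
rewrite (esum_esum (a := fun i j => a (i, j)))//.
rewrite -(reindex_esum setT setT g a bij_g)//.
by congr esum; [apply/seteqP; split|apply: funext => -[]].
Qed.

(** Give [F i] the share [e / 2 ^ i.+1] of the error, and list all the cubes used as one sequence
    through a bijection from [nat] to pairs. *)
Lemma hausdorff_measure_bigcup_box_null s A (F : nat -> set 'rV[R]_d) :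
  0 <= s -> A `<=` \bigcup_i F i -> (forall i, box_null s (F i)) ->
  hausdorff_measure s A = 0%E.
Proof.
move=> s0 AF Fnull; have pre_le0 delta e : 0 < delta -> 0 < e ->
    (hausdorff_premeasure s delta A <= e%:E)%E.
  move=> delta0 e0.
  (* [D] exceeds the ratio of diameter to side, and adding 1 keeps it positive when [d] is 0. *)
  pose D : R := d%:R + 1; pose K := D `^ s.
  have D0 : 0 < D by rewrite ltr_wpDl.
  have K0 : 0 < K by rewrite powR_gt0.
  (* The first term keeps diameters below [delta]; the second absorbs the factor [K] by which the
     weights grow when sides become diameters. *)
  pose eps i := Num.min (delta / D) (e / (2 ^ i.+1)%:R / K).
  have eps0 i : 0 < eps i.
    by rewrite lt_min !divr_gt0// ltr0n expn_gt0.
  have /choice[C /choice[r CP]] i := Fnull i _ (eps0 i).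
  (* Each finite family is padded with empty sets, which have weight 0 for every [s] and diameter
     [-oo]. *)
  pose G i j : set 'rV[R]_d :=
    if (j < size (C i))%N then cube (nth 0 (C i) j) (r i) else set0.
  have rD i : d%:R * r i <= D * r i /\ D * r i <= delta.
    have [/andP[r0 + _] _] := CP i; rewrite le_min => /andP[rle _]; split.
      by rewrite ler_wpM2r// lerDl.
    by rewrite mulrC -ler_pdivlMr.
  have /card_esym/ppcard_eqP[g] := card_nat2.
  apply: (@le_trans _ _ (\sum_(0 <= k <oo) diam_pow s (uncurry G (g k)))%E).
    apply: ereal_inf_lbound; exists (uncurry G \o g) => //; split.
      move=> x /AF[i _ Fix]; have [_ Fsub _] := CP i.
      have [c /= cC cx] := Fsub x Fix.
      exists (g^-1%FUN (i, index c (C i))) => //=.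
      by rewrite invK ?inE//= /G index_mem cC nth_index.
    move=> k /=; case: (g k) => i j /=; rewrite /G.
    have [/andP[r0 _] _ _] := CP i; have [rD1 rD2] := rD i.
    case: ifP => _; last by rewrite diam0 leNye.
    by rewrite (le_trans (diam_cube_le _ _ r0))// lee_fin (le_trans rD1).
  rewrite (nneseries_pair g (fun p => diam_pow s (uncurry G p)))//; last first.
    by move=> ?; exact: diam_pow_ge0.
  apply: (le_trans _ (epsilon_trick0 xpredT (ltW e0))).
  apply: lee_nneseries => i _.
    by move=> _; apply: nneseries_ge0 => j _ _; exact: diam_pow_ge0.
  have [/andP[r0 rle] _ Csz] := CP i.
  rewrite (nneseries_split 0 (size (C i))); last first.
    by move=> *; exact: diam_pow_ge0.
  rewrite [X in (_ + X)%E]eseries0 ?adde0 ; last first.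
    move=> j + _ /=; rewrite /G leqNgt => /negbTE ->.
    by rewrite /diam_pow eqxx.
  apply: (@le_trans _ _ (\sum_(0 <= j < 0 + size (C i)) ((D * r i) `^ s)%:E)%E).
    rewrite big_nat_cond [leRHS]big_nat_cond; apply: lee_sum => j.
    rewrite andbT add0n => /andP[_ jlt]; rewrite /G /= jlt.
    rewrite (le_trans (diam_pow_cube_le _ _ _ s0 r0))// lee_fin.
    by rewrite ge0_ler_powR// ?nnegrE ?mulr_ge0// ?(ltW D0)//; case: (rD i).
  rewrite sumEFin lee_fin sumr_const_nat add0n subn0.
  rewrite powRM ?(ltW D0)// -[leLHS]mulr_natl mulrCA.
  rewrite mulrC -ler_pdivlMr// (le_trans Csz)// /eps.
  by rewrite ge_min lexx orbT.
apply/eqP; rewrite eq_le; apply/andP; split.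
  apply: ge_ereal_sup => _ [delta delta0 <-].
  by apply/lee_addgt0Pr => e e0; rewrite add0e pre_le0.
apply: (@le_trans _ _ (hausdorff_premeasure s 1 A)).
  apply: le_ereal_inf_tmp => _ [U _ ->].
  by apply: nneseries_ge0 => *; exact: diam_pow_ge0.
by apply: ereal_sup_ubound; exists 1 => //=.
Qed.
End BoxCovers.

(** * Porous sets and their covers *)

Lemma exists_expr_le {R : realType} (q e C : R) :
  0 <= q < 1 -> 0 < e -> 0 <= C -> exists k : nat, C * q ^+ k <= e.
Proof.
move=> /andP[q0 q1] e0 C0.
have /cvgr0Pnorm_le/(_ (e / (C + 1))) : q ^+ k @[k --> \oo] --> 0.
  by apply: cvg_expr; rewrite ger0_norm.
rewrite divr_gt0 ?ltr_wpDl// => /(_ isT) [k _ /(_ k (leqnn _))] /=.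
rewrite ger0_norm ?exprn_ge0// ler_pdivlMr ?ltr_wpDl// mulrDr mulr1 => qk.
by exists k; have := exprn_ge0 k q0; lra.
Qed.

(** The intervals are closed, so the right end [m] falls into the last one. *)
Lemma exists_ord_unit_interval {R : realType} (m : nat) (x : R) : (0 < m)%N ->
  0 <= x <= m%:R -> exists t : 'I_m, t%:R <= x <= t%:R + 1.
Proof.
elim: m => // -[|m] IH _ /andP[x0 xm].
  by exists ord0; rewrite /= x0 add0r.
have [xm1|xm1] := leP x m.+1%:R.
  have [|t tx] := IH (ltn0Sn _); first by rewrite x0.
  by exists (widen_ord (leqnSn _) t).
by exists ord_max; rewrite (ltW xm1) /= natr1.
Qed.

Section Porosity.
Context {R : realType} {d : nat}.
Implicit Types (a c u x : 'rV[R]_d) (E : set 'rV[R]_d) (r : R).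

Definition subcube_corner m a r (t : {ffun 'I_d -> 'I_m}) : 'rV[R]_d :=
  \row_i (a 0 i + r / m%:R * (t i)%:R).

Lemma cube_subcube m a r u : (0 < m)%N -> 0 < r -> cube a r u ->
  exists t : {ffun 'I_d -> 'I_m}, cube (subcube_corner m a r t) (r / m%:R) u.
Proof.
move=> m0 r0 au; have rm0 : 0 < r / m%:R by rewrite divr_gt0 ?ltr0n.
have mE : r / m%:R * m%:R = r by rewrite divfK// pnatr_eq0 -lt0n.
have /fin_all_exists[t tP] i : exists t : 'I_m,
    t%:R <= (u 0 i - a 0 i) / (r / m%:R) <= t%:R + 1.
  apply: exists_ord_unit_interval => //.
  have /andP[? ?] := au i; rewrite divr_ge0 ?(ltW rm0) ?subr_ge0//=.
  by rewrite ler_pdivrMr// mulrC mE; lra.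
exists (finfun t) => i; rewrite !mxE ffunE.
have := tP i; rewrite ler_pdivlMr// ler_pdivrMr// => /andP[? ?].
by apply/andP; split; lra.
Qed.

(** The hole is a closed sup-norm ball; only its centre has to lie in the given cube. *)
Definition porous E (r0 kappa : R) := forall a r, 0 < r <= r0 ->
  exists2 u, cube a r u &
    forall x, (forall i, `|x 0 i - u 0 i| <= kappa * r) -> ~ E x.

(** The subcube containing the centre of the hole has side at most the radius of the hole, hence
    lies inside it. *)
Lemma porous_subcube_disjoint E r0 kappa m a r : porous E r0 kappa ->
  (0 < m)%N -> m%:R^-1 <= kappa -> 0 < r <= r0 ->
  exists t : {ffun 'I_d -> 'I_m},
    forall x, cube (subcube_corner m a r t) (r / m%:R) x -> ~ E x.
Proof.
move=> porE m0 mk /[dup] /andP[r_gt0 _] rr0; have [u au uE] := porE a r rr0.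
have [t tu] := cube_subcube m a r u m0 r_gt0 au.
exists t => x tx; apply: uE => i.
have /andP[? ?] := tx i; have /andP[? ?] := tu i.
have : r / m%:R <= kappa * r by rewrite mulrC ler_wpM2r ?(ltW r_gt0).
by rewrite ler_distl => ?; apply/andP; split; lra.
Qed.

(** Refine every cube of the cover into [m ^ d] subcubes and discard the one that misses [E]. *)
Lemma porous_cover E r0 kappa m a : porous E r0 kappa -> 0 < r0 ->
  (0 < m)%N -> m%:R^-1 <= kappa -> E `<=` cube a r0 ->
  forall k, exists2 C : seq 'rV[R]_d, size C = ((m ^ d).-1 ^ k)%N &
    E `<=` \bigcup_(c in [set` C]) cube c (r0 / m%:R ^+ k).
Proof.
move=> porE r0_gt0 m0 mk Ea; elim=> [|k [C sizeC EC]].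
  exists [:: a] => // x Ex; exists a; first by rewrite /= inE.
  by rewrite expr0 divr1; exact: Ea.
set r := r0 / m%:R ^+ k.
have m1 : 1 <= m%:R :> R by rewrite ler1n.
have r_r0 : 0 < r <= r0.
  rewrite divr_gt0 ?exprn_gt0 ?ltr0n//= ler_pdivrMr ?exprn_gt0 ?ltr0n//.
  by rewrite ler_peMr ?(ltW r0_gt0)// exprn_ege1.
have /choice[t tP] c :=
  porous_subcube_disjoint E r0 kappa m c r porE m0 mk r_r0.
pose sub c := [seq subcube_corner m c r t' | t' <- enum (predC1 (t c))].
exists (flatten [seq sub c | c <- C]).
  rewrite size_flatten /shape -map_comp sumnE big_map.
  under eq_bigr do rewrite /= size_map -cardE cardC1 card_ffun !card_ord.
  rewrite big_const_seq count_predT sizeC iter_addn_0.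
  by rewrite expnS.
move=> x Ex; have [c /= cC cx] := EC x Ex.
have /andP[r_gt0 _] := r_r0.
have [t' t'x] := cube_subcube m c r x m0 r_gt0 cx.
exists (subcube_corner m c r t'); last first.
  by rewrite exprSr invfM mulrA.
apply/flattenP; exists (sub c); first exact: map_f.
apply: map_f; rewrite mem_enum inE; apply/eqP => t't.
by apply: (tP c x) => //; rewrite -t't.
Qed.

(* The exponent is chosen so that [m `^ s] is the midpoint of
   [m ^ d - 1] and [m ^ d]. *)
Lemma porous_box_null E r0 kappa a : (0 < d)%N -> 0 < r0 -> 0 < kappa ->
  porous E r0 kappa -> E `<=` cube a r0 ->
  exists2 s, 0 <= s < d%:R & box_null s E.
Proof.
move=> d0 r0_gt0 k0 porE Ea.
have [m m1 mk] : exists2 m : nat, (1 < m)%N & m%:R^-1 <= kappa.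
  exists (Num.Def.archi_bound kappa^-1).+2 => //.
  rewrite invf_ple ?posrE//.
  have kV0 : 0 <= kappa^-1 by rewrite invr_ge0 ltW.
  by rewrite (le_trans (ltW (archi_boundP kV0)))// ler_nat -addn2 leq_addr.
have m0 := ltnW m1.
have mR1 : 1 < m%:R :> R by rewrite ltr1n.
have mR0 : 0 < m%:R :> R by rewrite ltr0n.
pose N := (m ^ d).-1.
have NE : N%:R + 1 = m%:R ^+ d :> R.
  by rewrite natr1 /N prednK ?expn_gt0 ?m0// natrX.
(* Here [m > 1] and [d > 0] enter; this gives [v >= 1], hence [s >= 0]. *)
have N1 : 1 <= N%:R :> R.
  rewrite ler1n /N -ltnS prednK ?expn_gt0 ?m0//.
  by rewrite -(exp1n d) ltn_exp2r.
pose v : R := N%:R + 2^-1.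
have v0 : 0 < v by rewrite /v; lra.
pose s := ln v / ln m%:R.
have lnm : 0 < ln m%:R :> R by rewrite ln_gt0.
have msv : m%:R `^ s = v.
  by rewrite /powR gt_eqF// /s divfK ?gt_eqF// lnK.
exists s.
  rewrite divr_ge0 ?(ltW lnm) ?ln_ge0//=; last by rewrite /v; lra.
  rewrite ltr_pdivrMr// -ln_powR powR_mulrn ?(ltW mR0)//.
  by rewrite ltr_ln ?posrE ?exprn_gt0// -NE /v; lra.
move=> e e0.
(* At level [k] the side is [r0 * m ^- k] and the weight is [r0 ^ s * (N / v) ^ k]. Both are at most
   [K * q ^ k], so one [k] serves both bounds. *)
pose q := Num.max m%:R^-1 (N%:R / v); pose K := Num.max r0 (r0 `^ s).
have K0 : 0 <= K by rewrite le_max (ltW r0_gt0).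
have [|k kP] := exists_expr_le q e K _ e0 K0.
  rewrite le_max invr_ge0 (ltW mR0)/= gt_max invf_lt1// mR1/=.
  by rewrite ltr_pdivrMr// /v; lra.
have [C sizeC EC] := porous_cover E r0 kappa m a porE r0_gt0 m0 mk Ea k.
have rk0 : 0 < r0 / m%:R ^+ k by rewrite divr_gt0 ?exprn_gt0.
exists C, (r0 / m%:R ^+ k); split => //.
  rewrite ltW//= (le_trans _ kP)// -exprVn; apply: ler_pM.
  - exact: ltW.
  - by rewrite exprn_ge0// invr_ge0 ltW.
  - by rewrite le_max lexx.
  - by rewrite lerXn2r ?nnegrE ?le_max ?lexx// ?invr_ge0 ?(ltW mR0).
have -> : (r0 / m%:R ^+ k) `^ s = r0 `^ s / v ^+ k.
  have mk0 : 0 < m%:R ^+ k :> R by rewrite exprn_gt0.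
  have <- : (r0 / m%:R ^+ k) `^ s * v ^+ k = r0 `^ s.
    rewrite -[v]msv -[(m%:R `^ s) ^+ k]powR_mulrn ?powR_ge0// powRAC.
    rewrite powR_mulrn ?(ltW mR0)// -powRM ?(ltW rk0) ?(ltW mk0)//.
    by rewrite divfK ?gt_eqF.
  by rewrite mulfK// gt_eqF// exprn_gt0.
rewrite sizeC natrX mulrCA -exprVn -exprMn (le_trans _ kP)//; apply: ler_pM.
- exact: powR_ge0.
- by rewrite exprn_ge0// divr_ge0// ltW.
- by rewrite le_max lexx orbT.
- by rewrite lerXn2r ?nnegrE ?le_max ?lexx ?orbT// ?divr_ge0// ?invr_ge0 ?ltW.
Qed.

End Porosity.

(** * Recording a bit sequence along an orbit *)

Section BinaryBranching.
Context {T : Type} {n : nat} (g : 'I_n -> T -> T) (G U : set T) (k l : 'I_n).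

Fixpoint reach (m : nat) (y : T) : Prop :=
  if m is m'.+1 then exists j, G (g j y) /\ reach m' (g j y) else U y.

(** On [G], [h] is the least number of steps to [U] and, off [U], [dig] is the first letter of a
    shortest path, so following [dig] lowers [h]. *)
Lemma reach_strategy : (forall y, G y -> exists m, reach m y) ->
  exists (h : T -> nat) (dig : T -> 'I_n), forall y, G y -> ~ U y ->
    G (g (dig y) y) /\ (h (g (dig y) y) < h y)%N.
Proof.
move=> Greach.
have /choice[h hP] y : exists m, G y ->
    reach m y /\ forall m', reach m' y -> (m <= m')%N.
  have [Gy|nGy] := pselect (G y); last by exists 0%N.
  have ex : exists m, `[< reach m y >].
    by have [m my] := Greach y Gy; exists m; apply/asboolP.
  have [m /asboolP my mmin] := ex_minnP ex.
  by exists m => _; split=> // m' ?; apply: mmin; apply/asboolP.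
exists h; suff /choice[dig digP] y : exists j, G y -> ~ U y ->
    G (g j y) /\ (h (g j y) < h y)%N by exists dig.
have [Gy|] := pselect (G y); last by exists k.
have [Uy|nUy] := pselect (U y); first by exists k.
have [+ _] := hP y Gy; case hy : (h y) => [//|m] /= [j [Gj rj]].
by exists j => _ _; split => //; rewrite ltnS; apply: (hP _ Gj).2.
Qed.

(* From every point of [G] some orbit runs inside [G] to a point of [U]; there
   both [k] and [l] are admissible, so the next bit can be recorded. *)
Lemma binary_branching : k != l -> (forall y, G y -> exists m, reach m y) ->
  (forall y, G y -> U y -> G (g k y) /\ G (g l y)) ->
  forall y, G y -> exists2 phi : (nat -> bool) -> nat -> 'I_n, injective phi &
    forall b, exists orb : nat -> T,
      [/\ orb 0%N = y, forall N, G (orb N) &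
          forall N, orb N.+1 = g (phi b N) (orb N)].
Proof.
move=> kl /reach_strategy[h [dig digP]] UG.
(* The state is a point with the bits still to be recorded: on [U] the head bit chooses [k] or [l]
   and is consumed, off [U] the strategy is followed and the bits are kept. *)
pose digit (yb : T * (nat -> bool)) : 'I_n :=
  if `[< U yb.1 >] then (if yb.2 0%N then k else l) else dig yb.1.
pose step (yb : T * (nat -> bool)) : T * (nat -> bool) :=
  (g (digit yb) yb.1, if `[< U yb.1 >] then fun i => yb.2 i.+1 else yb.2).
pose phi y b N := digit (iter N step (y, b)).
have Gdigit y b : G y -> G (g (digit (y, b)) y).
  move=> Gy; rewrite /digit /=; case: asboolP => Uy; last by case: (digP y).
  by have [? ?] := UG y Gy Uy; case: (b 0%N).
have phiS y b N : phi y b N.+1 = phi (step (y, b)).1 (step (y, b)).2 N.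
  by rewrite /phi iterSr -surjective_pairing.
(* Until the first visit to [U] the two runs coincide; there, as [k != l], equal digits force equal
   head bits, and the tails continue from a common point [y']. The induction is on a bound for
   [h y]. *)
have head_eq m y b b' : (h y < m)%N -> G y -> phi y b = phi y b' ->
    b 0%N = b' 0%N /\ exists2 y', G y' &
      phi y' (fun i => b i.+1) = phi y' (fun i => b' i.+1).
  elim: m y => // m IH y; rewrite ltnS => hm Gy eq_phi.
  have digit_eq : digit (y, b) = digit (y, b') := congr1 (@^~ 0%N) eq_phi.
  have : phi (step (y, b)).1 (step (y, b)).2 =
         phi (step (y, b')).1 (step (y, b')).2.
    by apply: funext => N; rewrite -!phiS eq_phi.
  have := Gdigit y b Gy; rewrite [step (y, b)]/step [step (y, b')]/step /=.
  rewrite -digit_eq; have [Uy|nUy] := pselect (U y).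
    rewrite asboolT// => Gy' eq_tail; split; last by eexists; first exact: Gy'.
    move: digit_eq kl; rewrite /digit /= asboolT//.
    by case: (b 0%N); case: (b' 0%N) => // ->; rewrite eqxx.
  rewrite asboolF// /digit /= asboolF// => Gy' eq_tail.
  apply: (IH (g (dig y) y)) => //.
  by apply: leq_trans hm; case: (digP y).
have phi_inj y : G y -> injective (phi y).
  move=> Gy b b' eq_phi; apply: funext => i.
  elim: i y b b' Gy eq_phi => [|i IH] y b b' Gy eq_phi.
    by have [] := head_eq _ y b b' (ltnSn _) Gy eq_phi.
  have [_ [y' Gy' eq']] := head_eq _ y b b' (ltnSn _) Gy eq_phi.
  exact: (IH y' _ _ Gy' eq').
move=> y Gy; exists (phi y); first exact: phi_inj.
move=> b; exists (fun N => (iter N step (y, b)).1); split => //.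
elim=> [//|N IH] /=.
by move: IH; case: (iter N step (y, b)) => z c /= Gz; exact: Gdigit.
Qed.

End BinaryBranching.

(** * Cardinality of sets of digit sequences *)

Lemma card_le_digit_sequences (n : nat) (A : set (nat -> 'I_n)) :
  (A #<= [set: nat -> bool])%card.
Proof.
(* A sequence is encoded by the indicator of its graph, a set of pickled pairs. *)
pose code (eps : nat -> 'I_n) (m : nat) : bool :=
  if unpickle m is Some ij then eps ij.1 == ij.2 :> 'I_n else false.
have code_inj : {in A &, injective code}.
  move=> eps eps' _ _ eq_code; apply: funext => i; apply/esym/eqP.
  have := congr1 (@^~ (pickle (i, eps i))) eq_code.
  by rewrite /code pickleK /= eqxx => /esym.
have /card_esym := inj_card_eq code_inj; rewrite card_eq_le => /andP[+ _].
by move/card_le_trans; apply; exact: card_leT.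
Qed.

Lemma has_continuum_card_digit_sequences (n : nat) (A : set (nat -> 'I_n))
    (phi : (nat -> bool) -> nat -> 'I_n) :
  injective phi -> (forall b, A (phi b)) -> has_continuum_card A.
Proof.
move=> phi_inj phiA; rewrite /has_continuum_card card_eq_le.
rewrite card_le_digit_sequences /=.
have phi_injT : {in [set: nat -> bool] &, injective phi} := in2W phi_inj.
have /card_esym := inj_card_eq phi_injT; rewrite card_eq_le => /andP[+ _].
move/card_le_trans; apply; apply: subset_card_le => _ [b _ <-]; exact: phiA.
Qed.

(** * Words of homotheties and porosity inside the attractor *)

Lemma prod_le_factor {R : realType} {I : finType} (a : I -> R) (j : I) :
  (forall i, 0 <= a i <= 1) -> \prod_i a i <= a j.
Proof.
move=> a01; rewrite (bigD1 j)//= ler_piMr//; first by case/andP: (a01 j).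
by apply: prodr_ile1 => i _; exact: a01.
Qed.

Section HomothetyIFS.
Context {R : realType} {d n : nat} (lam : 'I_n -> R) (p : 'I_n -> 'rV[R]_d).
Context (lam01 : forall j, 0 < lam j < 1).
Implicit Types (x y : 'rV[R]_d) (w : seq 'I_n) (L : set 'rV[R]_d).
Notation f := (homothety_ifs lam p).

Definition homothety_inv (j : 'I_n) y : 'rV[R]_d :=
  (lam j)^-1 *: (y - (1 - lam j) *: p j).

(** The head of a word is the outermost map, as in a coding, so [word_inv] undoes the head first. *)
Definition word_map w y : 'rV[R]_d := foldr f y w.
Definition word_inv w y : 'rV[R]_d := foldl (fun z j => homothety_inv j z) y w.
Definition word_ratio w : R := \prod_(j <- w) lam j.

Let lam_gt0 j : 0 < lam j. Proof. by case/andP: (lam01 j). Qed.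
Let lam_neq0 j : lam j != 0. Proof. by rewrite gt_eqF. Qed.

Lemma homothety_invK j y : f j (homothety_inv j y) = y.
Proof.
by rewrite /homothety_ifs /homothety_inv scalerA divff// scale1r subrK.
Qed.

Lemma homothetyK j y : homothety_inv j (f j y) = y.
Proof.
by rewrite /homothety_ifs /homothety_inv addrK scalerA mulVf// scale1r.
Qed.

Lemma word_mapK w y : word_inv w (word_map w y) = y.
Proof.
by elim: w y => //= j w IH y; rewrite /word_inv /= homothetyK; exact: IH.
Qed.

Lemma word_invK w y : word_map w (word_inv w y) = y.
Proof.
elim: w y => //= j w IH y.
by rewrite -[word_inv _ _]/(word_inv w (homothety_inv j y)) IH homothety_invK.
Qed.

Lemma word_inv_cat w v y : word_inv (w ++ v) y = word_inv v (word_inv w y).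
Proof. exact: foldl_cat. Qed.

Lemma word_mapB w x y :
  word_map w x - word_map w y = word_ratio w *: (x - y).
Proof.
rewrite /word_ratio; elim: w => [|j w IH] /=; first by rewrite big_nil scale1r.
rewrite big_cons -scalerA -IH /homothety_ifs opprD addrACA subrr addr0.
by rewrite -scalerBr.
Qed.

Lemma word_ratio_gt0 w : 0 < word_ratio w.
Proof. by apply: prodr_gt0 => j _. Qed.

Lemma word_ratio_le1 w : word_ratio w <= 1.
Proof.
by apply: prodr_ile1 => j _; have /andP[/ltW -> /ltW ->] := lam01 j.
Qed.

(** A word maps cubes to cubes with sides scaled by [word_ratio w <= 1], so the image cover has the
    same size and obeys the same bounds. *)
Lemma box_null_word_map s w (E : set 'rV[R]_d) : 0 <= s ->
  box_null s E -> box_null s (word_map w @` E).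
Proof.
move=> s0 Enull e e0; have [C [r [/andP[r0 re] EC Cr]]] := Enull e e0.
have rw0 := ltW (word_ratio_gt0 w).
have rwr : word_ratio w * r <= r by rewrite ler_piMl// word_ratio_le1.
exists [seq word_map w c | c <- C], (word_ratio w * r); split.
- by rewrite mulr_ge0//= (le_trans rwr).
- move=> _ [x Ex <-]; have [c /= cC cx] := EC x Ex.
  exists (word_map w c); first exact: map_f.
  move=> i; have /andP[c1 c2] := cx i.
  have /rowP/(_ i) := word_mapB w x c; rewrite !mxE => E1.
  have : 0 <= word_ratio w * (x 0 i - c 0 i) <= word_ratio w * r.
    by rewrite mulr_ge0 ?subr_ge0//= ler_wpM2l//; lra.
  by rewrite -E1 => /andP[? ?]; apply/andP; split; lra.
- rewrite size_map (le_trans _ Cr)// ler_wpM2l//.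
  by rewrite ge0_ler_powR// nnegrE ?mulr_ge0.
Qed.

(** Products replace the minimum and maximum of the ratios, which also covers [n = 0]: a product of
    numbers in [0, 1] is at most each factor. *)
Lemma lam_bounds :
  exists c q : R, [/\ 0 < c, 0 <= q < 1 & forall j, c <= lam j <= q].
Proof.
have le01 j : (0 <= lam j <= 1) /\ (0 <= 1 - lam j <= 1).
  by have /andP[? ?] := lam01 j; split; apply/andP; split; lra.
exists (\prod_j lam j), (1 - \prod_j (1 - lam j)); split.
- by apply: prodr_gt0.
- rewrite subr_ge0 prodr_ile1 /=; last by move=> j _; case: (le01 j).
  rewrite ltrBlDr ltrDl; apply: prodr_gt0 => j _.
  by rewrite subr_gt0; case/andP: (lam01 j).
- move=> j; rewrite prod_le_factor/=; last by move=> i; case: (le01 i).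
  have := @prod_le_factor R _ (fun j => 1 - lam j) j (fun i => (le01 i).2).
  lra.
Qed.

Section Attractor.
Context (L : set 'rV[R]_d) (L_attr : is_attractor f L).

Lemma attractor_map j y : L y -> L (f j y).
Proof.
have [_ _ LE] := L_attr.
by move=> Ly; rewrite LE; exists j => //; exists y.
Qed.

Lemma attractor_inv y : L y -> exists j, L (homothety_inv j y).
Proof.
have [_ _ LE] := L_attr; rewrite {1}LE => -[j _ [z Lz <-]].
by exists j; rewrite homothetyK.
Qed.

Lemma attractor_word_map w y : L y -> L (word_map w y).
Proof. by elim: w => //= j w IH /IH; exact: attractor_map. Qed.

(* Deepening the word one letter at a time divides the ratio by a bounded
   factor, so it cannot jump over the interval [c * r, r]. *)
Lemma attractor_word_scale c q y r : 0 < c -> 0 <= q < 1 ->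
  (forall j, c <= lam j <= q) -> L y -> 0 < r <= 1 ->
  exists2 w, L (word_inv w y) & c * r <= word_ratio w <= r.
Proof.
move=> c0 q01 cq Ly /andP[r0 r1].
have q0 : 0 <= q by case/andP: q01.
(* Either a suitable word has been found, or some word still has ratio at least [r]; the latter
   fails once [q ^ N <= r / 2]. *)
have step N : (exists2 w, L (word_inv w y) & c * r <= word_ratio w <= r) \/
    exists2 w, L (word_inv w y) & r <= word_ratio w <= q ^+ N.
  elim: N => [|N [|[w Lw /andP[rw wq]]]]; [right|by left|].
    by exists [::] => //; rewrite /word_ratio big_nil expr0 r1 lexx.
  have [j Lj] := attractor_inv _ Lw.
  have Lwj : L (word_inv (rcons w j) y) by rewrite -cats1 word_inv_cat.
  have wjE : word_ratio (rcons w j) = word_ratio w * lam j.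
    by rewrite /word_ratio big_rcons.
  have /andP[cj jq] := cq j.
  have [wjr|rwj] := leP (word_ratio (rcons w j)) r.
    left; exists (rcons w j) => //; rewrite wjr andbT wjE mulrC.
    by rewrite ler_pM// ltW.
  right; exists (rcons w j) => //; rewrite ltW//= wjE exprSr.
  by rewrite ler_pM// ltW// word_ratio_gt0.
have [|N] := exists_expr_le q (r / 2) 1 q01 _ ler01; first by rewrite divr_gt0.
rewrite mul1r => qN.
have [//|[w _ /andP[? ?]]] := step N; lra.
Qed.

Definition avoiding (U : set 'rV[R]_d) : set 'rV[R]_d :=
  [set y | L y /\ forall w, ~ U (word_inv w y)].

(** If no avoiding point is within [r / 4] of the centre of the cube, the centre is a hole.
    Otherwise pull such a point [y] back by a word [w] of ratio about [r / (8 * M)]: then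
    [word_map w u0] is within [r / 4] of [y], hence in the cube, and the image under [w] of the ball
    about [u0] in [U] is a hole. *)
Lemma porous_avoiding (U : set 'rV[R]_d) (u0 : 'rV[R]_d) (rho M : R) :
  0 < rho -> 0 < M ->
  (forall x, (forall i, `|x 0 i - u0 0 i| <= rho) -> U x) -> L u0 ->
  (forall x, L x -> forall i, `|x 0 i| <= M) ->
  exists2 kappa, 0 < kappa & porous (avoiding U) (2 * M) kappa.
Proof.
move=> rho0 M0 ballU Lu0 LM; have [c [q [c0 q01 cq]]] := lam_bounds.
(* The terms serve the two cases. Coordinates of points of [L] differ by at most [2 * M], so a ratio
   at most [r / (8 * M)] moves them by at most [r / 4]. *)
pose kappa := Num.min 4^-1 (rho * c / (8 * M)).
have M8 : 0 < 8 * M by rewrite mulr_gt0.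
exists kappa; first by rewrite lt_min invr_gt0 ltr0n /= divr_gt0// mulr_gt0.
move=> a r /andP[r0 rM].
have [kr1 kr2] : kappa * r <= r / 4 /\ kappa * r <= rho * (c * (r / (8 * M))).
  split; first by rewrite mulrC ler_wpM2l ?(ltW r0)// ge_min lexx.
  have -> : rho * (c * (r / (8 * M))) = rho * c / (8 * M) * r by ring.
  by rewrite ler_wpM2r ?(ltW r0)// ge_min lexx orbT.
pose z : 'rV[R]_d := \row_i (a 0 i + r / 2).
have [[y [[Ly yU] yz]]|none] :=
    pselect (exists y, avoiding U y /\ forall i, `|y 0 i - z 0 i| <= r / 4);
    last first.
  exists z; first by move=> i; rewrite mxE; apply/andP; split; lra.
  move=> x xz Ex; apply: none; exists x; split => // i.
  exact: le_trans (xz i) kr1.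
have rM1 : 0 < r / (8 * M) <= 1.
  by rewrite divr_gt0//= ler_pdivrMr//; lra.
have [w Lw /andP[cw wr]] := attractor_word_scale c q y _ c0 q01 cq Ly rM1.
have w0 := word_ratio_gt0 w.
exists (word_map w u0).
  move=> i; have /rowP/(_ i) := word_mapB w u0 (word_inv w y).
  rewrite word_invK !mxE => uyE.
  have : `|word_ratio w * (u0 0 i - word_inv w y 0 i)| <= r / 4.
    rewrite normrM gtr0_norm//.
    have -> : r / 4 = r / (8 * M) * (2 * M) by field; rewrite gt_eqF.
    rewrite ler_pM ?(ltW w0)// (le_trans (ler_normB _ _))//.
    by have := LM _ Lu0 i; have := LM _ Lw i; lra.
  have := yz i; rewrite mxE -uyE !ler_norml => /andP[? ?] /andP[? ?].
  by apply/andP; split; lra.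
move=> x xu [_ /(_ w)]; apply; apply: ballU => i.
have /rowP/(_ i) := word_mapB w (word_inv w x) u0.
rewrite word_invK !mxE => xuE.
have := xu i; rewrite xuE normrM gtr0_norm// => /le_trans/(_ kr2) le1.
by rewrite -(ler_pM2l w0) (le_trans le1)// mulrC ler_wpM2r// ltW.
Qed.

End Attractor.
End HomothetyIFS.

Lemma normr_mx_le {R : realType} {d : nat} (x : 'rV[R]_d) i : `|x 0 i| <= `|x|.
Proof.
rewrite -[leRHS]/(mx_norm x) mx_normrE.
exact: (le_bigmax _ (fun ij : 'I_1 * 'I_d => `|x ij.1 ij.2|) (0, i)).
Qed.

(** * Codings from inverse orbits, and recurrent points *)

Section Codings.
Context {R : realType} {d n : nat} (lam : 'I_n -> R) (p : 'I_n -> 'rV[R]_d).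
Context (lam01 : forall j, 0 < lam j < 1).
Context (L : set 'rV[R]_d) (L_attr : is_attractor (homothety_ifs lam p) L).
Notation f := (homothety_ifs lam p).
Notation finv := (homothety_inv lam p).

Lemma attractor_bounded : exists2 M : R, 0 < M & forall x, L x -> `|x| <= M.
Proof.
have [_ Lc _] := L_attr; have [M [_ MP]] := compact_bounded Lc.
exists (`|M| + 1); first by rewrite ltr_wpDl.
by move=> x Lx; apply: MP => //; rewrite (le_lt_trans (ler_norm M))// ltrDl.
Qed.

Lemma prefix_comp_dist q (eps : nat -> 'I_n) N a b : 0 <= q ->
  (forall j, lam j <= q) ->
  `|prefix_comp f eps N a - prefix_comp f eps N b| <= q ^+ N * `|a - b|.
Proof.
move=> q0 lamq; elim: N a b => [|N IH] a b; first by rewrite expr0 mul1r.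
rewrite /= (le_trans (IH _ _))// exprSr -mulrA ler_wpM2l ?exprn_ge0//.
rewrite /homothety_ifs opprD addrACA subrr addr0 -scalerBr normrZ ler_wpM2r//.
by rewrite gtr0_norm//; case/andP: (lam01 (eps N)).
Qed.

(** The prefix of length [N] maps [orb N] to [x] and contracts by [q ^ N], while [orb N] stays
    bounded; so its value at 0 tends to [x]. *)
Lemma codings_orbit x (eps : nat -> 'I_n) (orb : nat -> 'rV[R]_d) :
  orb 0%N = x -> (forall N, L (orb N)) ->
  (forall N, orb N.+1 = finv (eps N) (orb N)) -> codings f x eps.
Proof.
move=> orb0 orbL orbS; have [M M0 LM] := attractor_bounded.
have [c [q [c0 /andP[q0 q1] cq]]] := lam_bounds lam lam01.
have lamq j : lam j <= q by case/andP: (cq j).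
have xE N : prefix_comp f eps N (orb N) = x.
  by elim: N => [//|N IH] /=; rewrite orbS homothety_invK.
apply/cvgrPdist_le => e e0.
have /cvg_expr/cvgr0Pnorm_le/(_ (e / M)) : `|q : R| < 1 by rewrite ger0_norm.
rewrite divr_gt0// => /(_ isT); apply: filterS => N.
rewrite ger0_norm ?exprn_ge0// ler_pdivlMr// => qN.
rewrite -(xE N) (le_trans (prefix_comp_dist q eps N _ _ q0 lamq))// subr0.
by rewrite (le_trans _ qN)// ler_wpM2l ?exprn_ge0// LM.
Qed.

Context (k l : 'I_n) (kl : k != l).
Let U := (f k @` L) `&` (f l @` L).

Lemma overlap_sub : U `<=` L.
Proof. by move=> _ [[z Lz <-] _]; exact: attractor_map. Qed.

(** Quantifying over all [w] makes this set stable under inverse branches that stay in [L], so it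
    can play the role of [G] in [binary_branching]. *)
Definition recurrent : set 'rV[R]_d :=
  [set y | L y /\ forall w, L (word_inv lam p w y) ->
    exists v, U (word_inv lam p v (word_inv lam p w y))].

Lemma recurrent_inv j y : recurrent y -> L (finv j y) -> recurrent (finv j y).
Proof. by move=> [_ yU] Lj; split => // w Lw; exact: (yU (j :: w)). Qed.

(** An inverse orbit ending in [U] lies in [L] throughout, because each of its points is a word
    image of the endpoint, which is in [L]. *)
Lemma recurrent_reach y : recurrent y ->
  exists m, reach finv recurrent U m y.
Proof.
move=> /[dup] ry [Ly /(_ [::] Ly)[v]]; rewrite [word_inv _ _ [::] y]/= => vU.
elim: v y ry {Ly} vU => [|j v IH] y ry vU; first by exists 0%N.
have Lj : L (finv j y).
  rewrite -(word_invK lam p lam01 v (finv j y)).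
  by apply: attractor_word_map => //; exact: overlap_sub.
have rj := recurrent_inv j y ry Lj.
by have [m rm] := IH (finv j y) rj vU; exists m.+1, j.
Qed.

Lemma recurrent_continuum x : recurrent x -> has_continuum_card (codings f x).
Proof.
move=> rx.
have branch y : recurrent y -> U y ->
    recurrent (finv k y) /\ recurrent (finv l y).
  move=> ry [[a La aE] [b Lb bE]]; split; apply: recurrent_inv => //.
    by rewrite -aE homothetyK.
  by rewrite -bE homothetyK.
have [phi phi_inj phiP] :=
  binary_branching finv recurrent U k l kl recurrent_reach branch x rx.
apply: (has_continuum_card_digit_sequences _ _ _ phi_inj) => b.
have [orb [orb0 orbG orbS]] := phiP b.
by apply: (codings_orbit x _ orb orb0 _ orbS) => N; have [] := orbG N.
Qed.

Lemma not_continuum_sub x : L x -> ~ has_continuum_card (codings f x) ->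
  exists2 w, avoiding lam p L U (word_inv lam p w x) &
             x = word_map lam p w (word_inv lam p w x).
Proof.
move=> Lx nx; have : ~ recurrent x by move=> /recurrent_continuum.
move=> /not_andP[//|/existsNP[w /not_implyP[Lw nU]]].
exists w; last by rewrite word_invK.
by split => // v vU; apply: nU; exists v.
Qed.

End Codings.

(** * The dimension bound, by a countable union over words *)

Theorem theorem1p3 (R : realType) (d n : nat) (d_gt0 : (0 < d)%N)
    (lam : 'I_n -> R) (p : 'I_n -> 'rV[R]_d)
    (lam01 : forall j : 'I_n, 0 < lam j < 1)
    (L : set 'rV[R]_d)
    (L_attr : is_attractor (homothety_ifs lam p) L)
    (overlap : exists k l : 'I_n, (k < l)%N /\
      ((homothety_ifs lam p k @` L) `&` (homothety_ifs lam p l @` L))°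
        !=set0) :
  (hausdorff_dim
     [set x | L x /\ ~ has_continuum_card (codings (homothety_ifs lam p) x)]
   < (d%:R)%:E)%E.
Proof.
have [k [l [k_lt_l [u0 u0int]]]] := overlap.
have kl : k != l by rewrite neq_ltn k_lt_l.
set U := (_ `&` _) in u0int.
have Lu0 : L u0 by exact: overlap_sub (interior_subset u0int).
have [M M0 LM] := attractor_bounded lam p L L_attr.
have LMi x : L x -> forall i, `|x 0 i| <= M.
  by move=> Lx i; exact: le_trans (normr_mx_le _ _) (LM _ Lx).
have [rho rho0 rhoU] : exists2 rho : R, 0 < rho &
    forall x : 'rV[R]_d, (forall i, `|x 0 i - u0 0 i| <= rho) -> U x.
  (* Halving turns the closed coordinatewise bound into the strict one of the open sup-norm ball. *)
  move: u0int => /nbhs_ballP[e e0 eU]; exists (e / 2).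
    by rewrite divr_gt0.
  move=> x xu; apply: eU; split => // i j; rewrite ord1 -ball_normE /=.
  by rewrite distrC (le_lt_trans (xu j))// gtr_pMr// invf_lt1// ltr1n.
have [kappa kappa0 por] :=
  porous_avoiding lam p lam01 L L_attr U u0 rho M rho0 M0 rhoU Lu0 LMi.
(* The starting cube is [[-M, M] ^ d], whose side [2 * M] is the largest scale of the porosity. *)
have [] := porous_box_null _ _ _ (const_mx (- M)) d_gt0 _ kappa0 por.
- by rewrite mulr_gt0.
- move=> x [Lx _] i; rewrite mxE; have := LMi x Lx i.
  by rewrite ler_norml => /andP[? ?]; apply/andP; split; lra.
move=> s /andP[s0 sd] null.
apply: (@le_lt_trans _ _ s%:E); last by rewrite lte_fin.
apply: ereal_inf_lbound; exists s => //=; split => //.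
(* Words are enumerated by their codes; an index that codes no word gives the empty set, covered by
   no cube at all. *)
pose F i : set 'rV[R]_d := if unpickle i is Some w
  then word_map lam p w @` avoiding lam p L U else set0.
apply: (@hausdorff_measure_bigcup_box_null _ _ _ _ F) => //.
  move=> x [Lx nx].
  have [w wE xE] := not_continuum_sub lam p lam01 L L_attr k l kl x Lx nx.
  exists (pickle w) => //; rewrite /F pickleK.
  by exists (word_inv lam p w x).
move=> i; rewrite /F; case: unpickle => [w|]; first exact: box_null_word_map.
move=> e e0; exists [::], 0; split => //; first by rewrite lexx ltW.
by rewrite mul0r ltW.
Qed.
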